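(* Let $k\ge 2$, let $f_1,\dots,f_{k-1}$ be smooth nowhere vanishing functions on an open interval $I\ni x_0$, and consider the equation $$\partial_x f_{k-1}\partial_x f_{k-2}\partial_x\cdots\partial_x f_2\partial_x f_1\partial_x u=0 .$$ For $2\le j\le k-1$, if the function $g_{2:j}(x)\frac{1}{f_1(x)}$ satisfies Liouville's condition, then $u_j(x,t)=f(t)\int_{x_0}^{x}\frac{g_{2:j}(s)}{f_1(s)}ds$ is a solution of the equation that is elementary with respect to $x$. In particular, if $\frac1{f_1(x)}$ satisfies Liouville's condition, then $u_1(x,t)=f(t)\int_{x_0}^x\frac{ds}{f_1(s)}$ is a solution that is elementary with respect to $x$.
   Context: Here $f(t)$ is any function of the parameter $t$. The resolving functions are defined, for $2\le j\le k-1$, by $g_{j:j}(x)=R_{f_j}(x):=\int_{x_0}^x\frac{ds}{f_j(s)}$ and $g_{i:j}(x)=\int_{x_0}^x\frac{g_{i+1:j}(s)}{f_i(s)}ds$ for $2\le i\le j-1$. Liouville's condition for a function $h(x)$: there exist $n$, constants $c_1,\dots,c_n\in\mathbb{C}$ and elementary functions $h_1,\dots,h_n$ (nowhere zero on $I$) and $s$ such that $h(x)=\sum_{i=1}^n c_i\frac{h_i'(x)}{h_i(x)}+s'(x)$ on $I$. Elementary functions: one considers differential fields whose elements are complex-valued functions of the real variable $x$ on a suitable open interval $I$ with derivation $d/dx$, starting from the field $\mathbb{C}(x)$ of rational functions (all fields can be taken inside the field of quotients of complex-valued real-analytic functions on $I$; the functions occurring in the statement are assumed defined and smooth on $I$).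 A simple extension $K\subset K(g)$ is called elementary if it is exponential ($g'=s'g$ for some $s\in K$), or logarithmic ($g'=s'/s$ for some nonzero $s\in K$), or algebraic ($g$ is a root of an irreducible polynomial over $K$). A function is elementary if it belongs to the last field of a finite chain $\mathbb{C}(x)\subset K_1\subset\dots\subset K_r$ of elementary extensions. A function of $(x,t)$ is elementary with respect to $x$ if it is an elementary function of $x$ for each fixed $t$. *)

(* Defs.v *)
Set Warnings "-notation-overridden,-ambiguous-paths,-redundant-canonical-projection".
From HB Require Import structures.
From Stdlib Require Import Reals Lra.
From mathcomp Require Import all_boot all_algebra boolp.
From Coquelicot Require Import Coquelicot.

Set Implicit Arguments.
Unset Strict Implicit.
Unset Printing Implicit Defensive.

Import GRing.Theory.

Local Open Scope R_scope.

Record ointerval := OInterval {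
  lower : Rbar;
  upper : Rbar;
  lower_lt_upper : Rbar_lt lower upper
}.

Definition in_interval (I : ointerval) (x : R) : Prop :=
  Rbar_lt (lower I) x /\ Rbar_lt x (upper I).
Coercion in_interval : ointerval >-> Funclass.

(* Derivative of a complex-valued function of a real variable; like [Derive],
   it is only meaningful where both components are differentiable. *)
Definition CDerive (h : R -> C) (x : R) : C :=
  (Derive (fun s => Re (h s)) x, Derive (fun s => Im (h s)) x).

Definition smooth_on (I : ointerval) (h : R -> C) : Prop :=
  forall (n : nat) (x : R), I x ->
    ex_derive_n (fun s => Re (h s)) n x /\ ex_derive_n (fun s => Im (h s)) n x.

(* Power series in the real variable with complex coefficients. *)
Definition analytic_at (h : R -> C) (a : R) : Prop :=
  exists (c : nat -> C) (r : R), 0 < r /\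
    forall x, Rabs (x - a) < r ->
      is_pseries (K := R_AbsRing) (V := C_R_NormedModule) c (x - a) (h x).

Definition analytic_on (I : ointerval) (h : R -> C) : Prop :=
  forall a, I a -> analytic_at h a.

Lemma interval_inhabited (I : ointerval) : exists x, I x.
Proof.
case: I => [[l| |] [u| |]] //= H; rewrite /in_interval /=.
- by exists ((l + u) / 2); lra.
- by exists (l + 1); lra.
- by exists (u - 1); lra.
- by exists 0.
Qed.

Lemma interval_open (I : ointerval) (a : R) :
  I a -> exists r, 0 < r /\ forall x, Rabs (x - a) < r -> I x.
Proof.
case: I => l u H [/= Hl Hu]; rewrite /in_interval /=.
have [rl [rl0 Hrl]] : exists r, 0 < r /\ forall x, Rabs (x - a) < r -> Rbar_lt l x.
  case: l {H} Hl => [l||] //= Hl; last by exists 1; split=> //; lra.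
  exists (a - l); split=> [|x /Rabs_def2 ?]; lra.
have [ru [ru0 Hru]] : exists r, 0 < r /\ forall x, Rabs (x - a) < r -> Rbar_lt x u.
  case: u {H} Hu => [u||] //= Hu; last by exists 1; split=> //; lra.
  exists (u - a); split=> [|x /Rabs_def2 ?]; lra.
exists (Rmin rl ru); split; first exact: Rmin_pos.
move=> x Hx; split; [apply: Hrl|apply: Hru]; apply: Rlt_le_trans Hx _;
  [exact: Rmin_l|exact: Rmin_r].
Qed.

Lemma interval_convex (I : ointerval) (a b x : R) :
  I a -> I b -> Rmin a b <= x <= Rmax a b -> I x.
Proof.
case: I => l u H [/= la au] [/= lb bu] [mx xM]; split=> /=.
- apply: (Rbar_lt_le_trans _ (Rmin a b)) => //.
  by rewrite /Rmin; case: Rle_dec.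
- apply: (Rbar_le_lt_trans (Finite x) (Finite (Rmax a b)) u) => //.
  by rewrite /Rmax; case: Rle_dec.
Qed.

Lemma Rbar_lt_le (x r : R) (l : Rbar) : x < r -> Rbar_le r l -> Rbar_lt x l.
Proof. by move=> xr; apply: (Rbar_lt_le_trans (Finite x) (Finite r)). Qed.

Definition real_analytic_at (f : R -> R) (a : R) : Prop :=
  exists (c : nat -> R) (r : R), [/\ 0 < r, Rbar_le r (CV_radius c) &
    forall x, Rabs (x - a) < r -> f x = PSeries c (x - a)].

Lemma CV_radius_ge (c : nat -> R) (r : R) :
  (forall y, Rabs y < r -> ex_pseries c y) -> Rbar_le r (CV_radius c).
Proof.
move=> H; apply: Rbar_not_lt_le => Hlt.
have H0 := CV_radius_ge_0 c.
case: (CV_radius c) (@CV_disk_outside c) Hlt H0 => [s| |] //= Hout Hlt H0.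
pose y := (s + r) / 2.
have ay : Rabs y = y by rewrite Rabs_pos_eq // /y; lra.
apply: (Hout y); first by rewrite ay /y; lra.
apply: ex_series_lim_0; apply/ex_pseries_R; apply: H; rewrite ay /y; lra.
Qed.

Lemma real_analytic_atP (f : R -> R) (a : R) :
  real_analytic_at f a <->
  exists (c : nat -> R) (r : R), 0 < r /\
    forall x, Rabs (x - a) < r -> is_pseries c (x - a) (f x).
Proof.
split=> [[c [r [r0 Hr H]]]|[c [r [r0 H]]]]; exists c, r.
- split=> // x Hx; rewrite H //; apply/PSeries_correct/CV_radius_inside.
  exact: (Rbar_lt_le Hx Hr).
- split=> //; last by move=> x Hx; rewrite (is_pseries_unique _ _ _ (H _ Hx)).
  apply: CV_radius_ge => y Hy; exists (f (a + y)).
  have := H (a + y); have -> : a + y - a = y by lra.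
  exact.
Qed.

Lemma sum_n_pair (u : nat -> C) n :
  sum_n (G := C_R_NormedModule) u n =
  (sum_n (fun k => Re (u k)) n, sum_n (fun k => Im (u k)) n) :> C.
Proof.
elim: n => [|n IH]; first by rewrite !sum_O; case: (u 0%N).
by rewrite !sum_Sn IH; case: (u n.+1).
Qed.

Lemma is_series_pair (u : nat -> C) (l : C) :
  is_series (V := C_R_NormedModule) u l <->
  is_series (fun k => Re (u k)) (Re l) /\ is_series (fun k => Im (u k)) (Im l).
Proof.
split=> [H|[H1 H2]].
- split.
  + apply: (filterlim_ext (fun n => fst (sum_n (G := C_R_NormedModule) u n : C))).
      by move=> n; rewrite sum_n_pair.
    apply: filterlim_comp H _ => P [e He]; exists e => y [Hy _]; exact: He.
  + apply: (filterlim_ext (fun n => snd (sum_n (G := C_R_NormedModule) u n : C))).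
      by move=> n; rewrite sum_n_pair.
    apply: filterlim_comp H _ => P [e He]; exists e => y [_ Hy]; exact: He.
- apply: (filterlim_ext (fun n => (sum_n (fun k => Re (u k)) n, sum_n (fun k => Im (u k)) n))).
    by move=> n; rewrite sum_n_pair.
  apply: filterlim_filter_le_2 (filterlim_pair _ _ H1 H2).
  move=> P [e He]; exists (ball (Re l) e) (ball (Im l) e); try exact: locally_ball.
  by move=> x y Hx Hy; apply: He.
Qed.

Lemma analytic_atP (h : R -> C) (a : R) :
  analytic_at h a <->
  real_analytic_at (fun x => Re (h x)) a /\ real_analytic_at (fun x => Im (h x)) a.
Proof.
have E1 (c : nat -> C) y k :
    Re (scal (K := R_AbsRing) (V := C_R_NormedModule) (pow_n (y : R_AbsRing) k) (c k)) = scal (pow_n (y : R_AbsRing) k) (Re (c k)).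
  by [].
have E2 (c : nat -> C) y k :
    Im (scal (K := R_AbsRing) (V := C_R_NormedModule) (pow_n (y : R_AbsRing) k) (c k)) = scal (pow_n (y : R_AbsRing) k) (Im (c k)).
  by [].
split=> [[c [r [r0 H]]]|].
- by split; apply/real_analytic_atP; [exists (fun k => Re (c k)), r|exists (fun k => Im (c k)), r];
    split=> // x /H /is_series_pair[].
- move=> [/real_analytic_atP[c [r [r0 H]]] /real_analytic_atP[c' [r' [r0' H']]]].
  exists (fun k => (c k, c' k)), (Rmin r r'); split; first exact: Rmin_pos.
  move=> x Hx; apply/is_series_pair; split.
  + apply: H; apply: Rlt_le_trans Hx _; exact: Rmin_l.
  + apply: H'; apply: Rlt_le_trans Hx _; exact: Rmin_r.
Qed.

Section RealAnalytic.
Implicit Types (f g : R -> R) (a : R).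

Lemma ra_ext f g a r : 0 < r -> (forall x, Rabs (x - a) < r -> f x = g x) ->
  real_analytic_at f a -> real_analytic_at g a.
Proof.
move=> r0 E [c [s [s0 Hs H]]]; exists c, (Rmin r s); split.
- exact: Rmin_pos.
- apply: Rbar_le_trans Hs; exact: Rmin_r.
- move=> x Hx; rewrite -E; [apply: H|]; apply: Rlt_le_trans Hx _; [exact: Rmin_r|exact: Rmin_l].
Qed.

Lemma ra_const k a : real_analytic_at (fun=> k) a.
Proof.
apply/real_analytic_atP; exists (fun n => if n is 0%N then k else 0), 1; split; first lra.
move=> x _; apply/is_pseries_R.
apply: (filterlim_ext (fun=> k)); last exact: filterlim_const.
move=> n; elim: n => [|n IH]; first by rewrite sum_O /=; ring.
by rewrite sum_Sn -IH /plus /=; ring.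
Qed.

Lemma ra_id a : real_analytic_at (fun x => x) a.
Proof.
apply/real_analytic_atP; exists (fun n => match n with 0%N => a | 1%N => 1 | _ => 0 end), 1; split; first lra.
move=> x _; apply/is_pseries_R; apply: (proj2 (is_lim_seq_incr_1 (sum_n _) x)).
apply: (filterlim_ext (fun=> x)); last exact: filterlim_const.
move=> n; elim: n => [|n IH]; first by rewrite sum_Sn sum_O /plus /=; ring.
by rewrite sum_Sn -IH /plus /=; ring.
Qed.

Lemma ra_plus f g a : real_analytic_at f a -> real_analytic_at g a ->
  real_analytic_at (fun x => f x + g x) a.
Proof.
move=> /real_analytic_atP[c [r [r0 H]]] /real_analytic_atP[c' [r' [r0' H']]].
apply/real_analytic_atP; exists (PS_plus c c'), (Rmin r r'); split; first exact: Rmin_pos.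
move=> x Hx; apply: is_pseries_plus; [apply: H|apply: H']; apply: Rlt_le_trans Hx _;
  [exact: Rmin_l|exact: Rmin_r].
Qed.

Lemma ra_mult f g a : real_analytic_at f a -> real_analytic_at g a ->
  real_analytic_at (fun x => f x * g x) a.
Proof.
move=> [c [r [r0 Hr H]]] [c' [r' [r0' Hr' H']]].
apply/real_analytic_atP; exists (PS_mult c c'), (Rmin r r'); split; first exact: Rmin_pos.
move=> x Hx.
have h1 : Rabs (x - a) < r by apply: Rlt_le_trans Hx _; exact: Rmin_l.
have h2 : Rabs (x - a) < r' by apply: Rlt_le_trans Hx _; exact: Rmin_r.
have h1' : Rbar_lt (Rabs (x - a)) (CV_radius c) by exact: (Rbar_lt_le h1 Hr).
have h2' : Rbar_lt (Rabs (x - a)) (CV_radius c') by exact: (Rbar_lt_le h2 Hr').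
rewrite H // H' //; apply: is_pseries_mult => //; apply: PSeries_correct; exact: CV_radius_inside.
Qed.

Lemma ra_opp f a : real_analytic_at f a -> real_analytic_at (fun x => - f x) a.
Proof.
move=> H; have := ra_mult (ra_const (-1) a) H.
apply: (@ra_ext _ _ _ 1); first lra.
move=> x _; ring.
Qed.

Lemma ra_is_derive f a c (r : R) : Rbar_le r (CV_radius c) ->
  (forall x, Rabs (x - a) < r -> f x = PSeries c (x - a)) ->
  forall x, Rabs (x - a) < r -> is_derive f x (PSeries (PS_derive c) (x - a)).
Proof.
move=> Hr H x Hx.
apply: (is_derive_ext_loc (fun x => PSeries c (x - a))).
  have e0 : 0 < r - Rabs (x - a) by lra.
  exists (mkposreal _ e0) => y; rewrite /ball /= /AbsRing_ball /abs /minus /plus /opp /= => Hy.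
  have yx : Rabs (Rminus y x) < r - Rabs (x - a) by exact: Hy.
  rewrite H //.
  have -> : Rminus y a = Rminus y x + (x - a) by rewrite /Rminus; ring.
  apply: Rle_lt_trans (Rabs_triang _ _) _; lra.
have := @is_derive_comp R_AbsRing R_NormedModule (PSeries c) (fun x => x - a) x (PSeries (PS_derive c) (x - a)) 1.
rewrite /scal /= /mult /= Rmult_1_l; apply.
- apply: is_derive_PSeries; exact: (Rbar_lt_le Hx Hr).
- by auto_derive.
Qed.

Lemma ra_ex_derive f a : real_analytic_at f a -> ex_derive f a.
Proof.
move=> [c [r [r0 Hr H]]]; exists (PSeries (PS_derive c) (a - a)).
apply: (ra_is_derive Hr H); rewrite Rminus_diag Rabs_R0 //.
Qed.

Lemma ra_derive f a : real_analytic_at f a -> real_analytic_at (Derive f) a.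
Proof.
move=> [c [r [r0 Hr H]]]; exists (PS_derive c), r; split=> //; first by rewrite CV_radius_derive.
move=> x Hx; apply: is_derive_unique; exact: (ra_is_derive Hr H).
Qed.

Lemma PSeries_zeros (n : nat) (c : nat -> R) : Rbar_lt 0 (CV_radius c) ->
  (forall e, 0 < e -> exists x, [/\ x <> 0, Rabs x < e & PSeries c x = 0]) -> c n = 0.
Proof.
have C0 (d : nat -> R) : Rbar_lt 0 (CV_radius d) ->
  (forall e, 0 < e -> exists x, [/\ x <> 0, Rabs x < e & PSeries d x = 0]) -> d 0%N = 0.
  move=> Hd H; case: (Req_dec (d 0%N) 0) => // d0; exfalso.
  have Hc : continuity_pt (PSeries d) 0 by apply: PSeries_continuity; rewrite Rabs_R0.
  case: (Hc (Rabs (d 0%N)) (Rabs_pos_lt _ d0)) => e [e0 He].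
  case: (H e e0) => x [x0 xe Px].
  have := He x; rewrite /= /Rdist Px PSeries_0 !Rminus_0_r.
  have -> : 0 - d 0%N = - d 0%N by ring.
  rewrite Rabs_Ropp => K; apply: (Rlt_irrefl (Rabs (d 0%N))); apply: K; split=> //; split=> //.
  by move=> E; apply: x0.
elim: n c => [|n IH] c Hc H; first exact: C0.
apply: (IH (PS_decr_1 c)); first by rewrite CV_radius_decr_1.
move=> e e0; case: (H e e0) => x [x0 xe Px]; exists x; split=> //.
have := PSeries_decr_1_aux c x (C0 c Hc H).
rewrite Px => /esym/Rmult_integral[]//.
Qed.

Lemma ra_locally_zero f a : real_analytic_at f a ->
  (forall e, 0 < e -> exists x, [/\ x <> a, Rabs (x - a) < e & f x = 0]) ->
  exists r, 0 < r /\ forall x, Rabs (x - a) < r -> f x = 0.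
Proof.
move=> [c [r [r0 Hr H]]] Hz; exists r; split=> // x Hx; rewrite H //.
rewrite (@PSeries_ext _ (fun=> 0)).
  by rewrite PSeries_const_0.
move=> n; apply: PSeries_zeros; first exact: (Rbar_lt_le r0 Hr).
move=> e e0; case: (Hz (Rmin e r)); first exact: Rmin_pos.
move=> y [ya ye fy]; exists (y - a); split; first lra.
- apply: Rlt_le_trans ye _; exact: Rmin_l.
- rewrite -H //; apply: Rlt_le_trans ye _; exact: Rmin_r.
Qed.

Lemma ra_identity (I : ointerval) f x1 :
  (forall a, I a -> real_analytic_at f a) -> I x1 ->
  (exists r, 0 < r /\ forall x, Rabs (x - x1) < r -> f x = 0) ->
  forall y, I y -> f y = 0.
Proof.
move=> fI Ix1 [r [r0 Hr]] y Iy.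
case: (Req_dec y x1) => [->|yx1]; first by apply: Hr; rewrite Rminus_diag Rabs_R0.
pose d := y - x1; pose p t := x1 + t * d.
have d0 : 0 < Rabs d by apply: Rabs_pos_lt; rewrite /d; lra.
have pI t : 0 <= t <= 1 -> I (p t).
  move=> [t0 t1]; apply: (interval_convex Ix1 Iy); rewrite /p /d /Rmin /Rmax.
  by case: Rle_dec => ?; split; nra.
have pB s t : Rabs (p s - p t) = Rabs (s - t) * Rabs d.
  by rewrite -Rabs_mult /p; congr Rabs; ring.
pose E t := 0 <= t <= 1 /\ forall s, 0 <= s <= t -> f (p s) = 0.
have E0 t : 0 <= t <= 1 -> t * Rabs d < r -> E t.
  move=> t01 tr; split=> // s st; apply: Hr.
  have -> : p s - x1 = p s - p 0 by rewrite /p; ring.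
  rewrite pB Rminus_0_r (Rabs_pos_eq s); last lra.
  by apply: Rle_lt_trans tr; apply: Rmult_le_compat_r; lra.
have [m [Um Lm]] : {m | is_lub E m}.
  apply: completeness; first by exists 1 => t [[]].
  by exists 0; apply: E0; lra.
have m1 : m <= 1 by apply: Lm => t [[]].
have m0 : 0 < m.
  pose t := Rmin 1 (r / Rabs d / 2).
  have q0 : 0 < r / Rabs d / 2 by have := Rdiv_lt_0_compat _ _ r0 d0; lra.
  have t0 : 0 < t by apply: Rmin_pos; lra.
  have t1 : t <= 1 by exact: Rmin_l.
  have : t <= r / Rabs d / 2 by exact: Rmin_r.
  clearbody t => tr; apply: (Rlt_le_trans _ _ _ t0); apply: Um; apply: E0; first lra.
  have -> : r = r / Rabs d / 2 * Rabs d * 2 by field; lra.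
  by nra.
have below s : 0 <= s < m -> f (p s) = 0.
  move=> [s0 sm]; apply: contrapT => fs.
  have : m <= s.
    apply: Lm => t [[t0 t1] Ht]; apply: Rnot_lt_le => st.
    by apply: fs; apply: Ht; lra.
  lra.
have [q [q0 Hq]] : exists q, 0 < q /\ forall x, Rabs (x - p m) < q -> f x = 0.
  apply: ra_locally_zero; first by apply/fI/pI; lra.
  move=> e e0; pose t := Rmax 0 (m - e / Rabs d / 2).
  have ed0 : 0 < e / Rabs d / 2 by have := Rdiv_lt_0_compat _ _ e0 d0; lra.
  have tm : t < m by apply: Rmax_lub_lt; lra.
  have t0 : 0 <= t by exact: Rmax_l.
  have tl : m - e / Rabs d / 2 <= t by exact: Rmax_r.
  clearbody t.
  exists (p t); split; last by apply: below; lra.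
    by move=> E1; have := pB t m; rewrite E1 Rminus_diag Rabs_R0 Rabs_left; nra.
  rewrite pB Rabs_left; last lra.
  have {1}-> : e = e / Rabs d / 2 * Rabs d * 2 by field; lra.
  by nra.
case: (Rle_lt_or_eq_dec _ _ m1) => [mlt|m1'].
  exfalso.
  pose t := Rmin 1 (m + q / Rabs d / 2).
  have qd0 : 0 < q / Rabs d / 2 by have := Rdiv_lt_0_compat _ _ q0 d0; lra.
  have tm : m < t by apply: Rmin_glb_lt; lra.
  have tl : t <= m + q / Rabs d / 2 by exact: Rmin_r.
  have t1 : t <= 1 by exact: Rmin_l.
  clearbody t; have : t <= m; last lra.
  apply: Um; split; first lra.
  move=> s [s0 st]; case: (Rlt_le_dec s m) => sm; first exact: below.
  apply: Hq; rewrite pB Rabs_pos_eq; last lra.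
  have {1}-> : q = q / Rabs d / 2 * Rabs d * 2 by field; lra.
  by nra.
have -> : y = p m by rewrite m1' /p /d; ring.
by apply: Hq; rewrite Rminus_diag Rabs_R0.
Qed.

End RealAnalytic.

Section ComplexAnalytic.
Implicit Types (h g : R -> C) (a : R).

Lemma analytic_ext (I : ointerval) h g :
  (forall x, I x -> h x = g x) -> analytic_on I h -> analytic_on I g.
Proof.
move=> E H a Ia; have [r [r0 Hr]] := interval_open Ia.
have /analytic_atP[H1 H2] := H a Ia.
by apply/analytic_atP; split; [apply: ra_ext H1|apply: ra_ext H2];
  eauto => x /Hr/E ->.
Qed.

Lemma analytic_const (z : C) a : analytic_at (fun=> z) a.
Proof. by apply/analytic_atP; split; exact: ra_const. Qed.

Lemma analytic_id a : analytic_at RtoC a.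
Proof. by apply/analytic_atP; split; [exact: ra_id|exact: ra_const]. Qed.

Lemma analytic_plus h g a :
  analytic_at h a -> analytic_at g a -> analytic_at (fun x => Cplus (h x) (g x)) a.
Proof.
move=> /analytic_atP[h1 h2] /analytic_atP[g1 g2].
by apply/analytic_atP; split; exact: ra_plus.
Qed.

Lemma analytic_opp h a : analytic_at h a -> analytic_at (fun x => Copp (h x)) a.
Proof.
move=> /analytic_atP[h1 h2].
by apply/analytic_atP; split; exact: ra_opp.
Qed.

Lemma analytic_mult h g a :
  analytic_at h a -> analytic_at g a -> analytic_at (fun x => Cmult (h x) (g x)) a.
Proof.
move=> /analytic_atP[h1 h2] /analytic_atP[g1 g2].
apply/analytic_atP; split=> /=.
- apply: ra_plus; first exact: ra_mult.
  by apply: ra_opp; exact: ra_mult.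
- by apply: ra_plus; exact: ra_mult.
Qed.

Lemma analytic_CDerive h a : analytic_at h a -> analytic_at (CDerive h) a.
Proof.
move=> /analytic_atP[h1 h2].
by apply/analytic_atP; split; exact: ra_derive.
Qed.

End ComplexAnalytic.

(* Analytic functions on I, extended by 0 outside I so that equality is
   equality on I. *)
Record afun (I : ointerval) := AFun {
  afun_val :> R -> C;
  afun_analytic : analytic_on I afun_val;
  afun_out : forall x, ~ I x -> afun_val x = RtoC 0
}.

Definition interval_dec (I : ointerval) (x : R) : {I x} + {~ I x} :=
  pselect (I x).

Definition restrict (I : ointerval) (h : R -> C) (x : R) : C :=
  if interval_dec I x then h x else RtoC 0.

Lemma restrictE (I : ointerval) h x : I x -> restrict I h x = h x.
Proof. by rewrite /restrict; case: interval_dec. Qed.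

Lemma restrict_analytic (I : ointerval) h :
  analytic_on I h -> analytic_on I (restrict I h).
Proof. by apply: analytic_ext => x Ix; rewrite restrictE. Qed.

Lemma restrict_out (I : ointerval) h x : ~ I x -> restrict I h x = RtoC 0.
Proof. by rewrite /restrict; case: interval_dec. Qed.

Definition to_afun (I : ointerval) h (H : analytic_on I h) : afun I :=
  AFun (restrict_analytic H) (@restrict_out I h).

Lemma afunP (I : ointerval) (p q : afun I) :
  (forall x, I x -> p x = q x) -> p = q.
Proof.
case: p q => p p1 p2 [q q1 q2] /= E.
have pq : p = q.
  apply: funext => x; case: (interval_dec I x) => Ix; first exact: E.
  by rewrite p2 // q2.
by subst q; congr AFun; exact: Prop_irrelevance.
Qed.

Section AFunRing.
Variable I : ointerval.
Implicit Types p q r : afun I.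

HB.instance Definition _ := gen_eqMixin (afun I).
HB.instance Definition _ := gen_choiceMixin (afun I).

Definition afun_const (z : C) : afun I :=
  to_afun (fun a (_ : I a) => analytic_const z a).
Definition afun_id : afun I := to_afun (fun a (_ : I a) => analytic_id a).
Definition afun_add p q : afun I :=
  to_afun (fun a Ia => analytic_plus (afun_analytic p Ia) (afun_analytic q Ia)).
Definition afun_opp p : afun I :=
  to_afun (fun a Ia => analytic_opp (afun_analytic p Ia)).
Definition afun_mul p q : afun I :=
  to_afun (fun a Ia => analytic_mult (afun_analytic p Ia) (afun_analytic q Ia)).
Definition afun_deriv p : afun I :=
  to_afun (fun a Ia => analytic_CDerive (afun_analytic p Ia)).

Local Ltac afun_tac :=
  intros; apply: afunP => ? ?;
  rewrite /afun_add /afun_mul /afun_opp /afun_const /= !restrictE //; ring.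

Fact afun_addA : associative afun_add. Proof. by move=> p q r; afun_tac. Qed.
Fact afun_addC : commutative afun_add. Proof. by move=> p q; afun_tac. Qed.
Fact afun_add0 : left_id (afun_const (RtoC 0)) afun_add.
Proof. by move=> p; afun_tac. Qed.
Fact afun_addN : left_inverse (afun_const (RtoC 0)) afun_opp afun_add.
Proof. by move=> p; afun_tac. Qed.

HB.instance Definition _ :=
  GRing.isZmodule.Build (afun I) afun_addA afun_addC afun_add0 afun_addN.

Fact afun_mulA : associative afun_mul. Proof. by move=> p q r; afun_tac. Qed.
Fact afun_mulC : commutative afun_mul. Proof. by move=> p q; afun_tac. Qed.
Fact afun_mul1 : left_id (afun_const (RtoC 1)) afun_mul.
Proof. by move=> p; afun_tac. Qed.
Fact afun_mulD : left_distributive afun_mul afun_add.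
Proof. by move=> p q r; afun_tac. Qed.
Fact afun_1_neq0 : afun_const (RtoC 1) != GRing.zero.
Proof.
apply/eqP => E; have [x Ix] := interval_inhabited I.
have : afun_const (RtoC 1) x = (GRing.zero : afun I) x by rewrite E.
by rewrite /= !restrictE //; case; lra.
Qed.

HB.instance Definition _ :=
  GRing.Zmodule_isComNzRing.Build (afun I)
    afun_mulA afun_mulC afun_mul1 afun_mulD afun_1_neq0.

Definition afun_unit : {pred afun I} := fun p => `[< exists q, (q * p = 1)%R >].
Definition afun_inv p : afun I :=
  if pselect (exists q, (q * p = 1)%R) is left H then projT1 (cid H) else p.

Fact afun_mulV : {in afun_unit, left_inverse 1%R afun_inv *%R}.
Proof.
move=> p /asboolP H; rewrite /afun_inv; case: pselect => // H'.
exact: (projT2 (cid H')).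
Qed.
Fact afun_unitP p q : (q * p = 1)%R -> afun_unit p.
Proof. by move=> H; apply/asboolP; exists q. Qed.
Fact afun_inv_out : {in [predC afun_unit], afun_inv =1 id}.
Proof.
move=> p /negP H; rewrite /afun_inv; case: pselect => // H'.
by case: H; apply/asboolP.
Qed.

HB.instance Definition _ :=
  GRing.ComNzRing_hasMulInverse.Build (afun I) afun_mulV afun_unitP afun_inv_out.

End AFunRing.

Lemma ra_nonzero (f : R -> R) (a : R) : real_analytic_at f a -> f a <> 0 ->
  exists r, 0 < r /\ forall x, Rabs (x - a) < r -> f x <> 0.
Proof.
move=> H fa; apply: contrapT => N.
have [|r [r0 Hr]] := ra_locally_zero H; last first.
  by apply: fa; apply: Hr; rewrite Rminus_diag Rabs_R0.
move=> e e0; apply: contrapT => Ne; apply: N; exists e; split=> // x xe fx.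
by apply: Ne; exists x; split=> // xa; apply: fa; rewrite -xa.
Qed.

Lemma analytic_nonzero (h : R -> C) (a : R) : analytic_at h a -> h a <> RtoC 0 ->
  exists r, 0 < r /\ forall x, Rabs (x - a) < r -> h x <> RtoC 0.
Proof.
move=> /analytic_atP[H1 H2] ha.
case: (Req_dec (Re (h a)) 0) => [Ra|Ra].
- case: (Req_dec (Im (h a)) 0) => [Ia|Ia].
    by case: ha; move: Ra Ia; case: (h a) => u v /= -> ->.
  have [r [r0 Hr]] := ra_nonzero H2 Ia; exists r; split=> // x /Hr N E.
  by apply: N; rewrite E.
- have [r [r0 Hr]] := ra_nonzero H1 Ra; exists r; split=> // x /Hr N E.
  by apply: N; rewrite E.
Qed.

Lemma analytic_identity (I : ointerval) (h : R -> C) (a : R) :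
  analytic_on I h -> I a ->
  (exists r, 0 < r /\ forall x, Rabs (x - a) < r -> h x = RtoC 0) ->
  forall x, I x -> h x = RtoC 0.
Proof.
move=> H Ia [r [r0 Hr]] x Ix.
have E1 : Re (h x) = 0.
  apply: (ra_identity (f := fun x => Re (h x)) _ Ia _ Ix).
    by move=> b /H /analytic_atP[].
  by exists r; split=> // y /Hr ->.
have E2 : Im (h x) = 0.
  apply: (ra_identity (f := fun x => Im (h x)) _ Ia _ Ix).
    by move=> b /H /analytic_atP[].
  by exists r; split=> // y /Hr ->.
by move: E1 E2; case: (h x) => u v /= -> ->.
Qed.

Section AFunDomain.
Variable I : ointerval.
Implicit Types p q : afun I.

Lemma afun0E x : (0%R : afun I) x = RtoC 0.
Proof. by rewrite /= /restrict; case: interval_dec. Qed.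
Lemma afun1E x : I x -> (1%R : afun I) x = RtoC 1.
Proof. by move=> Ix; rewrite /= restrictE. Qed.
Lemma afunDE p q x : I x -> (p + q)%R x = Cplus (p x) (q x).
Proof. by move=> Ix; rewrite /= restrictE. Qed.
Lemma afunNE p x : I x -> (- p)%R x = Copp (p x).
Proof. by move=> Ix; rewrite /= restrictE. Qed.
Lemma afunME p q x : I x -> (p * q)%R x = Cmult (p x) (q x).
Proof. by move=> Ix; rewrite /= restrictE. Qed.

Fact afun_integral p q : (p * q = 0)%R -> (p == 0%R) || (q == 0%R).
Proof.
move=> pq; case: (eqVneq p 0%R) => //= /eqP p0; apply/eqP.
have [a [Ia pa]] : exists a, I a /\ p a <> RtoC 0.
  apply: contrapT => N; apply: p0; apply: afunP => x Ix; rewrite afun0E.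
  by apply: contrapT => px; apply: N; exists x.
have [r [r0 Hr]] := analytic_nonzero (afun_analytic p Ia) pa.
have [s [s0 Hs]] := interval_open Ia.
apply: afunP => x Ix; rewrite afun0E.
apply: (analytic_identity (afun_analytic q) Ia) => //.
exists (Rmin r s); split=> [|y Hy]; first exact: Rmin_pos.
have /Hr py : Rabs (y - a) < r by apply: Rlt_le_trans Hy _; exact: Rmin_l.
have /Hs Iy : Rabs (y - a) < s by apply: Rlt_le_trans Hy _; exact: Rmin_r.
have E : Cmult (p y) (q y) = RtoC 0 by rewrite -afunME // pq afun0E.
apply: contrapT => qy; exact: (Cmult_neq_0 _ _ py qy).
Qed.

HB.instance Definition _ := GRing.ComUnitRing_isIntegral.Build (afun I) afun_integral.

Lemma afun_derivD p q :
  afun_deriv (p + q)%R = (afun_deriv p + afun_deriv q)%R.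
Proof.
apply: afunP => x Ix; rewrite afunDE // /afun_deriv.
rewrite [LHS]restrictE // [X in Cplus X _]restrictE // [X in Cplus _ X]restrictE //.
have [r [r0 Hr]] := interval_open Ix.
have L : locally x (fun y => I y) by exists (mkposreal r r0) => y; exact: Hr.
have /analytic_atP[/ra_ex_derive p1 /ra_ex_derive p2] := afun_analytic p Ix.
have /analytic_atP[/ra_ex_derive q1 /ra_ex_derive q2] := afun_analytic q Ix.
rewrite /CDerive /Cplus /=; congr pair.
- rewrite -Derive_plus //; apply: Derive_ext_loc.
  by apply: filter_imp L => y Iy; rewrite restrictE.
- rewrite -Derive_plus //; apply: Derive_ext_loc.
  by apply: filter_imp L => y Iy; rewrite restrictE.
Qed.

Lemma afun_derivM p q :
  afun_deriv (p * q)%R = (afun_deriv p * q + p * afun_deriv q)%R.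
Proof.
apply: afunP => x Ix; rewrite afunDE // !afunME // /afun_deriv.
rewrite [LHS]restrictE // [X in Cmult X _]restrictE // [X in Cmult (p x) X]restrictE //.
have [r [r0 Hr]] := interval_open Ix.
have L : locally x (fun y => I y) by exists (mkposreal r r0) => y; exact: Hr.
have /analytic_atP[/ra_ex_derive p1 /ra_ex_derive p2] := afun_analytic p Ix.
have /analytic_atP[/ra_ex_derive q1 /ra_ex_derive q2] := afun_analytic q Ix.
rewrite /CDerive /Cplus /Cmult /=; congr pair.
- rewrite (Derive_ext_loc _ (fun s => Re (p s) * Re (q s) - Im (p s) * Im (q s))).
    rewrite Derive_minus; try exact: ex_derive_mult.
    by rewrite !Derive_mult // /Re /Im; ring.
  by apply: filter_imp L => y Iy; rewrite restrictE.
- rewrite (Derive_ext_loc _ (fun s => Re (p s) * Im (q s) + Im (p s) * Re (q s))).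
    rewrite Derive_plus; try exact: ex_derive_mult.
    by rewrite !Derive_mult // /Re /Im; ring.
  by apply: filter_imp L => y Iy; rewrite restrictE.
Qed.

End AFunDomain.

(* The field of quotients of complex-valued real-analytic functions on I. *)
Notation mero I := {fraction afun I}.

Section Meromorphic.
Local Open Scope ring_scope.
Local Open Scope quotient_scope.
Local Notation "p %:F" := (@FracField.tofrac _ p).

Lemma frac_repr (R : idomainType) (phi : {fraction R}) :
  phi = (\n_(repr phi))%:F / (\d_(repr phi))%:F.
Proof.
have d0 := denom_ratioP (repr phi).
apply: (canRL (mulfK _)); first by rewrite tofrac_eq0.
rewrite -[phi in LHS]reprK; unlock FracField.tofrac.
rewrite -[LHS]FracField.pi_mul; apply/eqmodP.
rewrite /= FracField.equivfE /FracField.mulf !numden_Ratio ?oner_eq0 ?mulr1 ?mulf_neq0 //.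
by rewrite reprK mulrC.
Qed.

Variable I : ointerval.

(* The derivation d/dx, by the quotient rule on the chosen representative;
   mderivE shows that the choice does not matter. *)
Definition mderiv (phi : mero I) : mero I :=
  let p := \n_(repr phi) in let q := \d_(repr phi) in
  (afun_deriv p * q - p * afun_deriv q)%:F / (q ^+ 2)%:F.

Lemma mderivE (p q : afun I) : q != 0 ->
  mderiv (p%:F / q%:F) = (afun_deriv p * q - p * afun_deriv q)%:F / (q ^+ 2)%:F.
Proof.
move=> q0; rewrite /mderiv; set phi := p%:F / q%:F.
have d0 := denom_ratioP (repr phi).
have := frac_repr phi; rewrite {1}/phi.
move: (\n_(repr phi)) (\d_(repr phi)) d0 => n d d0.
move=> /eqP; rewrite eqr_div ?tofrac_eq0 // -!tofracM tofrac_eq => /eqP E.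
have DE : afun_deriv n * q =
    afun_deriv p * d + p * afun_deriv d - n * afun_deriv q.
  by rewrite -afun_derivM E afun_derivM addrK.
apply/eqP; rewrite eqr_div ?tofrac_eq0 ?expf_neq0 // -!tofracM tofrac_eq.
rewrite !expr2 !mulrBl mulrACA DE.
rewrite [n * _ * (q * q)]mulrACA -E [_ * d * (_ * q)]mulrACA.
rewrite !mulrBl mulrDl addrAC addrK.
rewrite [d * q]mulrC [_ * d * (q * d)]mulrACA; apply/eqP.
by rewrite [n * afun_deriv q * _]mulrACA -E [p * d * _]mulrACA.
Qed.

End Meromorphic.

Section Elementary.
Local Open Scope ring_scope.
Local Notation "p %:F" := (@FracField.tofrac _ p).
Variable I : ointerval.
Implicit Types (S K : {pred mero I}) (g : mero I).

(* Smallest subfield containing S. *)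
Definition subfield_gen S : {pred mero I} := fun y =>
  `[< forall K : {pred mero I}, divring_closed K -> {subset S <= K} -> y \in K >].

Definition adjoin K g : {pred mero I} := subfield_gen [predU1 g & K].

(* C(x): generated as a field by x and the complex constants. *)
Definition Cx : {pred mero I} :=
  subfield_gen (fun y =>
    `[< y = (afun_id I)%:F \/ exists z : C, y = (afun_const I z)%:F >]).

Definition exponential_over K g : Prop :=
  exists2 s, s \in K & mderiv g = mderiv s * g.

Definition logarithmic_over K g : Prop :=
  exists2 s, s \in K & s != 0 /\ mderiv g = mderiv s / s.

(* Irreducibility in K[X]; [size P] is 1 + degree, and the polynomials of size
   1 are the units. The library's [irreducible_poly] is irreducibility over the
   whole coefficient field, here mero I. *)
Definition irreducible_over K (P : {poly mero I}) : Prop :=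
  [/\ P \is a polyOver K, (1 < size P)%N &
    forall Q1 Q2 : {poly mero I}, Q1 \is a polyOver K -> Q2 \is a polyOver K ->
      P = Q1 * Q2 -> size Q1 = 1%N \/ size Q2 = 1%N].

Definition algebraic_over K g : Prop :=
  exists2 P, irreducible_over K P & root P g.

(* The last fields of chains C(x), K_1, ..., K_r of elementary extensions. Each
   of them is stable under mderiv, by the shape of its generators. *)
Inductive elementary_field : {pred mero I} -> Prop :=
| elementary_base : elementary_field Cx
| elementary_step K g :
    elementary_field K ->
    [\/ exponential_over K g, logarithmic_over K g | algebraic_over K g] ->
    elementary_field (adjoin K g).

(* h = p / q as functions on I; this says nothing about h at the zeros of q. *)
Definition represents (h : R -> C) (phi : mero I) : Prop :=
  exists p q : afun I, [/\ q != 0, phi = p%:F / q%:F &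
    forall x, I x -> Cmult (h x) (q x) = p x].

(* Smoothness determines h on I, including at the zeros of the denominator, from
   the element phi that it represents. *)
Definition elementary (h : R -> C) : Prop :=
  smooth_on I h /\
  exists (K : {pred mero I}) (phi : mero I),
    [/\ elementary_field K, phi \in K & represents h phi].

End Elementary.

Section Equation.
Variable I : ointerval.

Definition elementary_wrt_x (T : Type) (u : R -> T -> C) : Prop :=
  forall t, elementary I (fun x => u x t).

Local Open Scope C_scope.

(* The sum is empty for n = 0. *)
Definition liouville (h : R -> C) : Prop :=
  exists (n : nat) (c : nat -> C) (hs : nat -> R -> C) (s : R -> C),
    [/\ forall i, (1 <= i <= n)%N ->
          elementary I (hs i) /\ forall x, I x -> hs i x <> 0,
        elementary I s &
        forall x, I x ->
          h x = sum_n_m (fun i => c i * (CDerive (hs i) x / hs i x)) 1 n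
                + CDerive s x].

Definition CInt (h : R -> C) (a b : R) : C :=
  RInt (V := C_R_CompleteNormedModule) h a b.

(* resolving_down f x0 j m is g_{j-m:j}. *)
Fixpoint resolving_down (f : nat -> R -> C) (x0 : R) (j m : nat) (x : R) : C :=
  match m with
  | 0%N => CInt (fun s => 1 / f j s) x0 x
  | m'.+1 => CInt (fun s => resolving_down f x0 j m' s / f (j - m)%N s) x0 x
  end.

Definition resolving (f : nat -> R -> C) (x0 : R) (i j : nat) : R -> C :=
  resolving_down f x0 j (j - i).

(* flux f u i is f_i d/dx f_{i-1} d/dx ... f_1 d/dx u. *)
Fixpoint flux (f : nat -> R -> C) (u : R -> C) (i : nat) : R -> C :=
  match i with
  | 0%N => u
  | i'.+1 => fun x => f i x * CDerive (flux f u i') x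
  end.

(* As f and u are smooth on I, every CDerive below is a genuine derivative. *)
Definition is_solution (k : nat) (f : nat -> R -> C) (T : Type)
    (u : R -> T -> C) : Prop :=
  forall t, smooth_on I (fun x => u x t) /\
    forall x, I x -> CDerive (flux f (fun s => u s t) k.-1) x = 0.

End Equation.

(* Main.v *)
Set Warnings "-notation-overridden,-ambiguous-paths,-redundant-canonical-projection".
Require Import Defs.
From Stdlib Require Import Reals Lra.
From mathcomp Require Import all_boot all_algebra boolp zify.
From Coquelicot Require Import Coquelicot.

Set Implicit Arguments.
Unset Strict Implicit.
Unset Printing Implicit Defensive.

Import GRing.Theory.

Local Open Scope R_scope.

(** Each application of [f_i d/dx] undoes one integration: with [g_{j+1:j} = 1],
    applying the first [i <= j] of them to [z * g_{1:j}], [g_{1:j}] being the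
    integral of [g_{2:j} / f_1], leaves [z * g_{i+1:j}] ([flux_iterated]). For
    [i = j] this is the constant [z], which the next derivative annihilates
    ([CDerive_flux_iterated]). The function [u_1] is the case [j = 1].

    That the integral of [h = sum_i c_i h_i' / h_i + s'] is elementary would be
    immediate if logarithms [log h_i] could be taken; what has to be produced is
    an analytic primitive of [h_i' / h_i] on the whole of [I]. An elementary
    function is only given as a smooth function [h] with [h q = p] for analytic
    [p] and [q], where [q] may have zeros. At such a zero the singularity of
    [p / q] is removable as [h] is continuous, so [h] is analytic after all
    ([analytic_quotient]). This rests on two facts on real power series: the
    reciprocal of a series with nonzero constant term has a positive radius of
    convergence ([ra_inv]), and powers of [x - a] can be divided out
    ([ra_quotient]). Consequently [h_i' / h_i] is analytic on [I] and so is its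
    primitive ([ra_primitive]), which is logarithmic over any field that contains
    [h_i] ([log_primitive]).

    The functions [h_i] and [s] may lie in different elementary fields. Two
    elementary fields lie in a common one, obtained by adjoining the generators
    of the second chain to the first field ([elementary_compositum]); an
    algebraic generator may acquire a smaller minimal polynomial in the process
    ([algebraic_overP]). In a field containing [s] and all the primitives, the
    analytic function [F = sum_i c_i log h_i + s] satisfies [F' = h], and
    the integral of [h] from [x0] to [x] is [F x - F x0]
    ([liouville_CInt_elementary]). In particular the solution is analytic, which
    settles its smoothness. *)

(** * Real power series: reciprocal, division, antiderivative *)

Section PowerSeriesReciprocal.
Variable a : nat -> R.

(** Course-of-values recursion: [recip_upto n] is correct on the indices up to
    [n], so that its diagonal is the sequence of coefficients of [1 / a]. *)
Fixpoint recip_upto (n : nat) : nat -> R :=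
  match n with
  | 0%N => fun=> / a 0%N
  | n'.+1 => fun m =>
      if (m <= n')%N then recip_upto n' m
      else - / a 0%N * sum_f_R0 (fun k => recip_upto n' k * a (n'.+1 - k)%N) n'
  end.

Definition PS_recip (n : nat) : R := recip_upto n n.

Lemma recip_uptoE n m : (m <= n)%N -> recip_upto n m = PS_recip m.
Proof.
elim: n => [|n IH]; first by rewrite leqn0 => /eqP ->.
rewrite leq_eqVlt => /orP[/eqP ->//|mn].
by rewrite /= -ltnS mn IH.
Qed.

Lemma PS_recipS n : PS_recip n.+1 =
  - / a 0%N * sum_f_R0 (fun k => PS_recip k * a (n.+1 - k)%N) n.
Proof.
rewrite /PS_recip /= ltnn; congr (_ * _).
by apply: PartSum.sum_eq => i /leP Hi; rewrite recip_uptoE.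
Qed.

Lemma PS_mult_recip n : a 0%N <> 0 ->
  PS_mult PS_recip a n = if n is 0%N then 1 else 0.
Proof.
move=> a0; rewrite /PS_mult; case: n => [|n]; first by rewrite /= /PS_recip /=; field.
rewrite tech5 PS_recipS.
have -> : (n.+1 - n.+1)%coq_nat = 0%N by apply: Nat.sub_diag.
rewrite (PartSum.sum_eq _ (fun k => PS_recip k * a (n.+1 - k)%N)) //.
by move: (sum_f_R0 _ _) => S; field.
Qed.

Lemma geometric_sum_telescope (m : R) n :
  sum_f_R0 (fun k => m * (1 + m) ^ k) n = (1 + m) ^ n.+1 - 1.
Proof. by elim: n => [|n IH]; [rewrite /=; ring|rewrite tech5 IH /=; ring]. Qed.

(** If [|a n| r^n <= M] then, with [m = M / |a 0|], the rescaled coefficients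
    [d n = |a 0| |PS_recip n| r^n] satisfy [d n.+1 <= m (d 0 + ... + d n)], whence
    [d n <= (1 + m)^n]. *)
Lemma PS_recip_bound (r M : R) n : a 0%N <> 0 -> 0 < r ->
  (forall k, Rabs (a k * r ^ k) <= M) ->
  Rabs (PS_recip n * r ^ n) <= / Rabs (a 0%N) * (1 + M / Rabs (a 0%N)) ^ n.
Proof.
move=> a0 r0 HM; set A := Rabs (a 0%N); set m := M / A.
have A0 : 0 < A by apply: Rabs_pos_lt.
have M0 : 0 <= M by apply: Rle_trans (HM 0%N); exact: Rabs_pos.
have m0 : 0 <= m by apply: Rmult_le_pos => //; apply/Rlt_le/Rinv_0_lt_compat.
elim/ltn_ind: n => -[_|n IH].
  by rewrite /= !Rmult_1_r /PS_recip /= Rabs_inv; apply: Rle_refl.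
rewrite PS_recipS.
have -> : - / a 0%N * sum_f_R0 (fun k => PS_recip k * a (n.+1 - k)%N) n * r ^ n.+1
  = - / a 0%N * sum_f_R0 (fun k => (PS_recip k * r ^ k) * (a (n.+1 - k)%N * r ^ (n.+1 - k)%N)) n.
  rewrite Rmult_assoc (Rmult_comm (sum_f_R0 _ _)) scal_sum; congr (_ * _).
  apply: PartSum.sum_eq => i /leP Hi.
  have -> : r ^ n.+1 = r ^ i * r ^ (n.+1 - i)%N.
    by rewrite -pow_add plusE subnKC // leqW.
  by ring.
rewrite Rabs_mult Rabs_Ropp Rabs_inv -/A.
apply: Rmult_le_compat_l; first by apply/Rlt_le/Rinv_0_lt_compat.
apply: Rle_trans (Rsum_abs _ _) _.
apply: (Rle_trans _ (sum_f_R0 (fun k => m * (1 + m) ^ k) n)); last first.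
  rewrite geometric_sum_telescope; lra.
apply: sum_Rle => i /leP Hi; rewrite Rabs_mult.
have -> : m * (1 + m) ^ i = (/ A * (1 + m) ^ i) * M by rewrite /m; field; lra.
apply: Rmult_le_compat; try exact: Rabs_pos; [exact: IH|exact: HM].
Qed.

Lemma CV_radius_recip : a 0%N <> 0 -> Rbar_lt 0 (CV_radius a) ->
  Rbar_lt 0 (CV_radius PS_recip).
Proof.
move=> a0 Ra; have [_ Ha] := CV_radius_bounded a.
have [r [M [r0 HM]]] : exists r M, 0 < r /\ forall k, Rabs (a k * r ^ k) <= M.
  apply: contrapT => N; have : Rbar_le (CV_radius a) 0.
    apply: Ha => r [M HM] /=; apply: Rnot_lt_le => r0; apply: N.
    by exists r, M.
  by apply: Rbar_lt_not_le.
have [Hb _] := CV_radius_bounded PS_recip.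
set A := Rabs (a 0%N); set m := M / A.
have A0 : 0 < A by apply: Rabs_pos_lt.
have M0 : 0 <= M by apply: Rle_trans (HM 0%N); exact: Rabs_pos.
have m0 : 0 <= m by apply: Rmult_le_pos => //; apply/Rlt_le/Rinv_0_lt_compat.
apply: (Rbar_lt_le_trans _ (Finite (r / (1 + m)))).
  by apply: Rdiv_lt_0_compat; lra.
apply: Hb; exists (/ A) => n.
have := PS_recip_bound n a0 r0 HM; rewrite -/A -/m => H.
have p0 : 0 < (1 + m) ^ n by apply: pow_lt; lra.
rewrite Rpow_mult_distr pow_inv -Rmult_assoc Rabs_mult Rabs_inv (Rabs_pos_eq _ (Rlt_le _ _ p0)).
apply: (Rmult_le_reg_r ((1 + m) ^ n)) => //.
by rewrite Rmult_assoc Rinv_l ?Rmult_1_r //; lra.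
Qed.

Lemma PSeries_recip x : a 0%N <> 0 ->
  Rbar_lt (Rabs x) (CV_radius a) -> Rbar_lt (Rabs x) (CV_radius PS_recip) ->
  PSeries PS_recip x * PSeries a x = 1.
Proof.
move=> a0 h1 h2; rewrite -PSeries_mult //.
rewrite (PSeries_ext _ (fun n => if n is 0%N then 1 else 0)); last first.
  by move=> n; exact: PS_mult_recip.
apply: is_pseries_unique; apply/is_pseries_R.
apply: (filterlim_ext (fun=> 1)); last exact: filterlim_const.
elim=> [|n IH]; first by rewrite sum_O /=; ring.
by rewrite sum_Sn -IH /plus /=; ring.
Qed.

End PowerSeriesReciprocal.

Lemma ra_inv (f : R -> R) a : real_analytic_at f a -> f a <> 0 ->
  real_analytic_at (fun x => / f x) a.
Proof.
move=> [c [r [r0 Hr H]]] fa.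
have c0 : c 0%N <> 0 by move: fa; rewrite H Rminus_diag ?PSeries_0 // Rabs_R0.
have Rc := CV_radius_recip c0 (Defs.Rbar_lt_le r0 Hr).
have [s [s0 Hs]] : exists s, 0 < s /\ Rbar_le s (CV_radius (PS_recip c)).
  case: (CV_radius _) Rc => [s||] //= s0; first by exists s; split=> //; apply: Rle_refl.
  by exists 1; split=> //; lra.
exists (PS_recip c), (Rmin r s); split; first exact: Rmin_pos.
- by apply: Rbar_le_trans Hs; exact: Rmin_r.
move=> x Hx.
have xr : Rabs (x - a) < r by apply: Rlt_le_trans Hx _; exact: Rmin_l.
have xs : Rabs (x - a) < s by apply: Rlt_le_trans Hx _; exact: Rmin_r.
have := PSeries_recip c0 (Defs.Rbar_lt_le xr Hr) (Defs.Rbar_lt_le xs Hs).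
rewrite -H // => E.
have fx : f x <> 0 by move=> fx; move: E; rewrite fx; lra.
by apply: (Rmult_eq_reg_r (f x)) => //; rewrite E Rinv_l.
Qed.

Lemma ra_continuous (f : R -> R) a : real_analytic_at f a -> continuous f a.
Proof. by move=> H; apply: ex_derive_continuous; exact: ra_ex_derive. Qed.

Lemma continuous_eq_punctured (f g : R -> R) a r : 0 < r ->
  continuous f a -> continuous g a ->
  (forall x, x <> a -> Rabs (x - a) < r -> f x = g x) -> f a = g a.
Proof.
move=> r0 fa ga E.
have H : continuous (fun x => minus (f x) (g x)) a by exact: continuous_minus.
apply: Rminus_diag_uniq; apply: contrapT => N.
have [d Hd] := H _ (locally_ball (minus (f a) (g a)) (mkposreal _ (Rabs_pos_lt _ N))).
pose x := a + Rmin r d / 2.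
have e0 : 0 < Rmin r d by apply: Rmin_pos => //; exact: cond_pos.
have er : Rmin r d <= r by exact: Rmin_l.
have ed : Rmin r d <= d by exact: Rmin_r.
have xa : Rabs (x - a) = Rmin r d / 2.
  by rewrite /x Rabs_pos_eq; lra.
have := Hd x; rewrite /ball /= /AbsRing_ball /abs /minus /plus /opp /=.
rewrite E; [|by rewrite /x; lra|by rewrite xa; lra].
have -> : Rplus (g x) (- g x) + - (f a + - g a) = - (f a - g a) by rewrite /Rminus; ring.
rewrite Rabs_Ropp => K; apply: (Rlt_irrefl (Rabs (f a - g a))); apply: K.
by change (Rabs (x - a) < d); lra.
Qed.

Lemma ra_factor (f : R -> R) a : real_analytic_at f a -> f a = 0 ->
  exists g, real_analytic_at g a /\
    exists r, 0 < r /\ forall x, Rabs (x - a) < r -> f x = (x - a) * g x.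
Proof.
move=> [c [r [r0 Hr H]]] fa.
have c0 : c 0%N = 0 by move: fa; rewrite H Rminus_diag ?PSeries_0 // Rabs_R0.
exists (fun x => PSeries (PS_decr_1 c) (x - a)); split.
  by exists (PS_decr_1 c), r; split=> //; rewrite CV_radius_decr_1.
by exists r; split=> // x Hx; rewrite H // PSeries_decr_1_aux.
Qed.

Lemma ra_div (f Q P : R -> R) a r : 0 < r ->
  real_analytic_at P a -> real_analytic_at Q a -> Q a <> 0 ->
  (forall x, Rabs (x - a) < r -> f x * Q x = P x) ->
  real_analytic_at f a.
Proof.
move=> r0 Pa QRA Qa HfQ; have [s [s0 Hs]] := ra_nonzero QRA Qa.
apply: (ra_ext (Rmin_pos _ _ r0 s0)) (ra_mult Pa (ra_inv QRA Qa)) => x Hx.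
have xr : Rabs (x - a) < r by apply: Rlt_le_trans Hx _; exact: Rmin_l.
have /Hs Qx : Rabs (x - a) < s by apply: Rlt_le_trans Hx _; exact: Rmin_r.
by rewrite -HfQ //; field.
Qed.

(** Removable singularities: if [f Q = P] then dividing [Q] and [P] by [x - a]
    as long as [Q] vanishes at [a] ([P] then vanishes there as well) leaves a
    quotient [P / Q] with [Q a <> 0]. The index [n] bounds the order of [Q]. *)
Lemma ra_quotient_order n (f Q P : R -> R) (c : nat -> R) a r : 0 < r ->
  continuous f a -> real_analytic_at P a ->
  Rbar_le r (CV_radius c) -> c n <> 0 ->
  (forall x, Rabs (x - a) < r -> Q x = PSeries c (x - a)) ->
  (forall x, Rabs (x - a) < r -> f x * Q x = P x) ->
  real_analytic_at f a.
Proof.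
elim: n Q P c r => [|n IH] Q P c r r0 fa Pa Hr cn HQ HfQ.
all: have QRA : real_analytic_at Q a by exists c, r.
all: have Q0 : Q a = c 0%N by rewrite HQ Rminus_diag ?PSeries_0 // Rabs_R0.
  by apply: (ra_div r0 Pa QRA) HfQ; rewrite Q0.
case: (Req_dec (c 0%N) 0) => [c0|]; last first.
  by move=> c0; apply: (ra_div r0 Pa QRA) HfQ; rewrite Q0.
have P0 : P a = 0 by rewrite -HfQ ?Q0 ?c0 ?Rmult_0_r // Rminus_diag Rabs_R0.
have [P' [P'a [s [s0 HP]]]] := ra_factor Pa P0.
have ms0 : 0 < Rmin r s by exact: Rmin_pos.
pose Q' x := PSeries (PS_decr_1 c) (x - a).
have Q'a : real_analytic_at Q' a.
  by exists (PS_decr_1 c), r; split=> //; rewrite CV_radius_decr_1.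
have off x : x <> a -> Rabs (x - a) < Rmin r s -> f x * Q' x = P' x.
  move=> xa Hx.
  have xr : Rabs (x - a) < r by apply: Rlt_le_trans Hx _; exact: Rmin_l.
  have xs : Rabs (x - a) < s by apply: Rlt_le_trans Hx _; exact: Rmin_r.
  have := HfQ x xr; rewrite HQ // HP // PSeries_decr_1_aux // => E.
  apply: (Rmult_eq_reg_l (x - a)); last lra.
  by rewrite -E /Q'; ring.
apply: (IH Q' P' (PS_decr_1 c) (Rmin r s)) => //.
- rewrite CV_radius_decr_1; apply: Rbar_le_trans Hr; exact: Rmin_l.
- move=> x Hx; case: (Req_dec x a) => [->|xa]; last exact: off.
  apply: (continuous_eq_punctured ms0) off; last exact: ra_continuous.
  by apply: (@continuous_mult _ R_AbsRing) => //; exact: ra_continuous.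
Qed.

Lemma ra_quotient (f Q P : R -> R) a r : 0 < r ->
  continuous f a -> real_analytic_at P a -> real_analytic_at Q a ->
  (forall e, 0 < e -> exists x, Rabs (x - a) < e /\ Q x <> 0) ->
  (forall x, Rabs (x - a) < r -> f x * Q x = P x) ->
  real_analytic_at f a.
Proof.
move=> r0 fa Pa [c [s [s0 Hs HQ]]] NQ HfQ.
have [n cn] : exists n, c n <> 0.
  apply: contrapT => N; have [x [xs]] := NQ s s0.
  rewrite HQ // (PSeries_ext _ (fun=> 0)) ?PSeries_const_0 // => n.
  by apply: contrapT => cn; apply: N; exists n.
apply: (@ra_quotient_order n f Q P c a (Rmin r s)) => //.
- exact: Rmin_pos.
- by apply: Rbar_le_trans Hs; exact: Rmin_r.
- by move=> x Hx; apply: HQ; apply: Rlt_le_trans Hx _; exact: Rmin_r.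
- by move=> x Hx; apply: HfQ; apply: Rlt_le_trans Hx _; exact: Rmin_l.
Qed.

(** Near [a] a primitive differs by a constant from the termwise primitive of
    the power series. *)
Lemma ra_primitive (F f : R -> R) a r : 0 < r -> real_analytic_at f a ->
  (forall x, Rabs (x - a) < r -> is_derive F x (f x)) ->
  real_analytic_at F a.
Proof.
move=> r0 [c [s [s0 Hs Hf]]] HF.
pose G x := PSeries (PS_Int c) (x - a).
have Ga : real_analytic_at G a by exists (PS_Int c), s; split=> //; rewrite CV_radius_Int.
have m0 : 0 < Rmin r s by exact: Rmin_pos.
have D x : Rabs (x - a) < Rmin r s -> is_derive (fun y => F y - G y) x 0.
  move=> Hx.
  have xr : Rabs (x - a) < r by apply: Rlt_le_trans Hx _; exact: Rmin_l.
  have xs : Rabs (x - a) < s by apply: Rlt_le_trans Hx _; exact: Rmin_r.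
  have -> : 0 = minus (f x) (f x) by rewrite minus_eq_zero.
  apply: is_derive_minus; first exact: HF.
  rewrite Hf // -(PSeries_ext (PS_derive (PS_Int c))).
    by apply: (@ra_is_derive G a (PS_Int c) s); rewrite ?CV_radius_Int.
  by move=> n; rewrite /PS_derive /PS_Int; field; exact: not_0_INR.
apply: (ra_ext m0) (ra_plus Ga (ra_const (F a - G a) a)) => x Hx.
suff -> : F a - G a = F x - G x by ring.
have Da t : Rmin x a <= t <= Rmax x a -> is_derive (fun y => F y - G y) t zero.
  move=> Ht; apply: D; move: Hx Ht; rewrite /Rmin /Rmax.
  by move=> /Rabs_def2 Hx; case: (Rle_dec x a) => ? Ht; apply: Rabs_def1; lra.
case: (Rtotal_order x a) => [xa|[->//|xa]].
- by apply/esym/(eq_is_derive (fun y => F y - G y)) => // t Ht; apply: Da;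
    rewrite Rmin_left ?Rmax_right; lra.
- by apply: (eq_is_derive (fun y => F y - G y)) => // t Ht; apply: Da;
    rewrite Rmin_right ?Rmax_left; lra.
Qed.

(** * Calculus of complex-valued functions of a real variable *)

Section ComplexCalculus.
Implicit Types (I : ointerval) (h g : R -> C) (x a : R).

Definition is_cderive h x (l : C) : Prop :=
  is_derive (fun s => Re (h s)) x (Re l) /\ is_derive (fun s => Im (h s)) x (Im l).

Definition ccontinuous h x : Prop :=
  continuous (fun s => Re (h s)) x /\ continuous (fun s => Im (h s)) x.

Lemma C_eq (z w : C) : Re z = Re w -> Im z = Im w -> z = w.
Proof. by case: z w => [u v] [u' v'] /= -> ->. Qed.

Lemma interval_locally I x : I x -> locally x (fun y => I y).
Proof. by move=> /interval_open[r [r0 Hr]]; exists (mkposreal r r0) => y; exact: Hr. Qed.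

Lemma is_cderive_unique h x l : is_cderive h x l -> CDerive h x = l.
Proof. by move=> [h1 h2]; apply: C_eq; exact: is_derive_unique. Qed.

Lemma is_cderive_ext I h g x l : (forall y, I y -> h y = g y) -> I x ->
  is_cderive h x l -> is_cderive g x l.
Proof.
move=> E /interval_locally L [h1 h2].
by split; [apply: is_derive_ext_loc h1|apply: is_derive_ext_loc h2];
  apply: filter_imp L => y /E ->.
Qed.

Lemma CDerive_ext I h g x : (forall y, I y -> h y = g y) -> I x ->
  CDerive h x = CDerive g x.
Proof.
move=> E /interval_locally L; apply: C_eq; apply: Derive_ext_loc;
  by apply: filter_imp L => y /E ->.
Qed.

Lemma is_cderive_const (z : C) x : is_cderive (fun=> z) x 0.
Proof. by split; exact: is_derive_const. Qed.

Lemma is_cderive_scal (z : C) h x l :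
  is_cderive h x l -> is_cderive (fun s => z * h s)%C x (z * l)%C.
Proof.
move=> [h1 h2]; split=> /=.
- by apply: is_derive_minus; apply: is_derive_scal.
- by apply: is_derive_plus; apply: is_derive_scal.
Qed.

Lemma is_cderive_plus h g x l m : is_cderive h x l -> is_cderive g x m ->
  is_cderive (fun s => h s + g s)%C x (l + m)%C.
Proof. by move=> [h1 h2] [g1 g2]; split; apply: is_derive_plus. Qed.

Lemma is_cderive_continuous h x l : is_cderive h x l -> ccontinuous h x.
Proof.
by move=> [h1 h2]; split; apply: ex_derive_continuous; eexists; eassumption.
Qed.

Lemma smooth_continuous I h x : smooth_on I h -> I x -> ccontinuous h x.
Proof. by move=> H Ix; have [? ?] := H 1%N x Ix; split; exact: ex_derive_continuous. Qed.

Lemma ccontinuous_mult h g x : ccontinuous h x -> ccontinuous g x ->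
  ccontinuous (fun s => h s * g s)%C x.
Proof.
move=> [h1 h2] [g1 g2]; split=> /=.
- by apply: continuous_minus; apply: (@continuous_mult _ R_AbsRing).
- by apply: continuous_plus; apply: (@continuous_mult _ R_AbsRing).
Qed.

Lemma sqr_norm_neq0 (z : C) : z <> 0 -> fst z ^ 2 + snd z ^ 2 <> 0.
Proof.
case: z => u v /= z0 E; apply: z0.
have u0 : u = 0 by nra.
have v0 : v = 0 by nra.
by rewrite u0 v0.
Qed.

Lemma ccontinuous_inv h x : ccontinuous h x -> h x <> 0 ->
  ccontinuous (fun s => / h s)%C x.
Proof.
move=> [h1 h2] /sqr_norm_neq0 hx.
have N : continuous (fun s => / (fst (h s) ^ 2 + snd (h s) ^ 2)) x.
  apply: (continuous_comp _ Rinv); last exact: continuous_Rinv.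
  by apply: continuous_plus; do 2! [apply: (@continuous_mult _ R_AbsRing) => //];
    exact: continuous_const.
split; rewrite /Cinv /= /Rdiv; apply: (@continuous_mult _ R_AbsRing) => //.
exact: continuous_opp.
Qed.

(** ** Integration *)

Lemma CInt_components I h x0 x : (forall y, I y -> ccontinuous h y) ->
  I x0 -> I x ->
  CInt h x0 x = (RInt (fun s => Re (h s)) x0 x, RInt (fun s => Im (h s)) x0 x).
Proof.
move=> H Ix0 Ix; apply: (@is_RInt_unique C_R_CompleteNormedModule).
apply: is_RInt_fct_extend_pair.
all: apply: RInt_correct; apply: ex_RInt_continuous => z Hz;
  by have [] := H z (interval_convex Ix0 Ix Hz).
Qed.

Lemma is_cderive_CInt I h x0 x : (forall y, I y -> ccontinuous h y) ->
  I x0 -> I x -> is_cderive (CInt h x0) x (h x).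
Proof.
move=> H Ix0 Ix; have [h1 h2] := H x Ix.
apply: (@is_cderive_ext I
  (fun y => (RInt (fun s => Re (h s)) x0 y, RInt (fun s => Im (h s)) x0 y))) => //.
  by move=> y Iy; rewrite (CInt_components H).
split=> /=.
all: [> apply: (is_derive_RInt (fun s => Re (h s)) _ x0) => //
      | apply: (is_derive_RInt (fun s => Im (h s)) _ x0) => //].
all: apply: filter_imp (interval_locally Ix) => y Iy.
all: apply: RInt_correct; apply: ex_RInt_continuous => z Hz;
  by have [] := H z (interval_convex Ix0 Iy Hz).
Qed.

(** ** Analytic functions *)

Lemma analytic_is_cderive h x : analytic_at h x -> is_cderive h x (CDerive h x).
Proof. by move=> /analytic_atP[h1 h2]; split; apply: Derive_correct; exact: ra_ex_derive. Qed.

Lemma analytic_smooth I h : analytic_on I h -> smooth_on I h.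
Proof.
have key (f : R -> R) n a : real_analytic_at f a -> real_analytic_at (Derive_n f n) a.
  by elim: n => [//|n IH] /IH; exact: ra_derive.
move=> H [//|n] x /H /analytic_atP[h1 h2].
by split; apply: ra_ex_derive; exact: key.
Qed.

(** [1 / h] is the conjugate of [h] times the reciprocal of the real function
    [|h|^2]. *)
Lemma analytic_inv h a : analytic_at h a -> h a <> 0 -> analytic_at (fun x => / h x)%C a.
Proof.
move=> /analytic_atP[h1 h2] /sqr_norm_neq0 ha.
have N : real_analytic_at (fun x => / (fst (h x) ^ 2 + snd (h x) ^ 2)) a.
  apply: ra_inv ha; apply: ra_plus; do 2! [apply: ra_mult => //]; exact: ra_const.
apply/analytic_atP; split; apply: ra_mult N => //; exact: ra_opp.
Qed.

Lemma analytic_primitive I h g : (forall x, I x -> is_cderive h x (g x)) ->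
  analytic_on I g -> analytic_on I h.
Proof.
move=> D G a Ia; have [r [r0 Hr]] := interval_open Ia.
have /analytic_atP[g1 g2] := G a Ia.
by apply/analytic_atP; split; [apply: ra_primitive r0 g1 _|apply: ra_primitive r0 g2 _];
  move=> x /Hr /D [].
Qed.

Lemma CInt_is_cderive I F h x0 x : (forall y, I y -> is_cderive F y (h y)) ->
  (forall y, I y -> ccontinuous h y) -> I x0 -> I x ->
  CInt h x0 x = (F x - F x0)%C.
Proof.
move=> D H Ix0 Ix; rewrite (CInt_components H) //; apply: C_eq => /=.
all: apply: is_RInt_unique.
- apply: (is_RInt_derive (fun y => Re (F y))) => z /(interval_convex Ix0 Ix) Iz.
    by have [] := D z Iz.
  by have [] := H z Iz.
- apply: (is_RInt_derive (fun y => Im (F y))) => z /(interval_convex Ix0 Ix) Iz.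
    by have [] := D z Iz.
  by have [] := H z Iz.
Qed.

(** Multiplying [h q = p] by the conjugate of [q] makes the denominator the real
    function [|q|^2], which reduces removability to the real case. *)
Lemma analytic_quotient I h (p q : afun I) : q <> 0%R ->
  (forall x, I x -> ccontinuous h x) ->
  (forall x, I x -> h x * q x = p x)%C -> analytic_on I h.
Proof.
move=> q0 H E a Ia; have [r [r0 Hr]] := interval_open Ia.
have [ha1 ha2] := H a Ia.
have /analytic_atP[q1 q2] := afun_analytic q Ia.
have /analytic_atP[p1 p2] := afun_analytic p Ia.
pose N x := Re (q x) * Re (q x) + Im (q x) * Im (q x).
have NA : real_analytic_at N a by apply: ra_plus; exact: ra_mult.
have NQ e : 0 < e -> exists x, Rabs (x - a) < e /\ N x <> 0.
  move=> e0; apply: contrapT => M; apply: q0; apply: afunP => x Ix; rewrite afun0E.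
  apply: (analytic_identity (afun_analytic q) Ia) => //; exists e; split=> // y ye.
  apply: contrapT => qy; apply: M; exists y; split=> //.
  by have := sqr_norm_neq0 qy; rewrite /N /Re /Im /= !Rmult_1_r.
apply/analytic_atP; split.
- apply: (ra_quotient r0 ha1 _ NA NQ
    (P := fun x => Re (p x) * Re (q x) + Im (p x) * Im (q x))).
    by apply: ra_plus; exact: ra_mult.
  move=> x /Hr/E <-; rewrite /N /Cmult /Re /Im /=; ring.
- apply: (ra_quotient r0 ha2 _ NA NQ
    (P := fun x => Im (p x) * Re (q x) + - (Re (p x) * Im (q x)))).
    by apply: ra_plus; [|apply: ra_opp]; exact: ra_mult.
  move=> x /Hr/E <-; rewrite /N /Cmult /Re /Im /=; ring.
Qed.

End ComplexCalculus.

(** * Elementary fields *)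

Section ElementaryFields.
Local Open Scope ring_scope.
Local Notation "p %:F" := (@FracField.tofrac _ p).
Variable I : ointerval.
Implicit Types (S K M : {pred mero I}) (g phi : mero I) (F G H L : afun I).

Lemma subfield_gen_closed S : divring_closed (subfield_gen S).
Proof.
split=> [|y z /asboolP Hy /asboolP Hz|y z /asboolP Hy /asboolP Hz].
all: apply/asboolP => K Kc SK; case: (Kc) => K1 KB Kd.
- exact: K1.
- by apply: KB; [exact: Hy|exact: Hz].
- by apply: Kd; [exact: Hy|exact: Hz].
Qed.

Lemma subfield_gen_sub S : {subset S <= subfield_gen S}.
Proof. by move=> y Sy; apply/asboolP => K _; apply. Qed.

Lemma subfield_gen_min S K : divring_closed K -> {subset S <= K} ->
  {subset subfield_gen S <= K}.
Proof. by move=> Kc SK y /asboolP; apply. Qed.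

Lemma adjoin_sub K g : {subset K <= adjoin K g}.
Proof. by move=> y Ky; apply: subfield_gen_sub; rewrite inE Ky orbT. Qed.

Lemma adjoin_gen K g : g \in adjoin K g.
Proof. by apply: subfield_gen_sub; rewrite inE eqxx. Qed.

Lemma adjoin_mono K K' g : {subset K <= K'} -> {subset adjoin K g <= adjoin K' g}.
Proof.
move=> KK'; apply: subfield_gen_min; first exact: subfield_gen_closed.
move=> y; rewrite inE => /orP[/eqP ->|/KK']; [exact: adjoin_gen|exact: adjoin_sub].
Qed.

Lemma elementary_field_closed K : elementary_field K -> divring_closed K.
Proof. by case=> *; exact: subfield_gen_closed. Qed.

Lemma elementary_field_Cx K : elementary_field K -> {subset @Cx I <= K}.
Proof. by elim=> // K' g _ IH _ y /IH; exact: adjoin_sub. Qed.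

Lemma elementary_field_const K (z : C) : elementary_field K -> (afun_const I z)%:F \in K.
Proof.
move=> /elementary_field_Cx; apply; apply: subfield_gen_sub.
by apply/asboolP; right; exists z.
Qed.

Lemma divring_closed_add K : divring_closed K -> {in K &, forall y z, y + z \in K}.
Proof.
move=> [K1 KB _] y z Ky Kz.
have K0 : 0 \in K by rewrite -(subrr 1); exact: KB.
by rewrite -[z]opprK; apply: (KB) => //; rewrite -sub0r; exact: KB.
Qed.

Lemma divring_closed_mul K : divring_closed K -> {in K &, forall y z, y * z \in K}.
Proof.
move=> [K1 _ Kd] y z Ky Kz.
by rewrite -[z]invrK; apply: (Kd) => //; rewrite -div1r; exact: Kd.
Qed.

(** Among the factors over [K] of a polynomial that have [g] as a root, one of
    least degree is irreducible. *)
Lemma algebraic_overP K g (P : {poly mero I}) : P \is a polyOver K ->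
  (1 < size P)%N -> root P g -> algebraic_over K g.
Proof.
move: {2}(size P) (leqnn (size P)) => n; elim: n P => [|n IH] P; first by case: size.
move=> Pn PK P1 Pg; apply: contrapT => N.
have : ~ irreducible_over K P by move=> PI; apply: N; exists P.
apply; split=> // Q1 Q2 Q1K Q2K PQ.
have P0 : P != 0 by rewrite -size_poly_gt0 ltnW.
have [Q10 Q20] : Q1 != 0 /\ Q2 != 0.
  by move: P0; rewrite PQ mulf_eq0 negb_or => /andP[].
have szP : size P = (size Q1 + size Q2).-1 by rewrite PQ size_mul.
have deg (Q : {poly mero I}) : Q != 0 -> root Q g -> (1 < size Q)%N.
  by move=> Q0 Qg; rewrite ltnNge; apply: contraL Qg => /size1_polyC E;
    move: Q0; rewrite E polyC_eq0 rootC.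
have big (Q : {poly mero I}) : Q \is a polyOver K -> Q != 0 -> root Q g ->
    (n < size Q)%N.
  move=> QK Q0 Qg; rewrite ltnNge; apply/negP => Qn.
  by apply: N; apply: (IH Q) => //; exact: deg.
move: Pg; rewrite PQ rootM => /orP[Qg|Qg]; [right|left].
- have := big Q1 Q1K Q10 Qg; move: Pn; rewrite szP.
  by move: Q20; rewrite -size_poly_gt0; lia.
- have := big Q2 Q2K Q20 Qg; move: Pn; rewrite szP.
  by move: Q10; rewrite -size_poly_gt0; lia.
Qed.

Lemma elementary_step_mono K K' g : {subset K <= K'} ->
  [\/ exponential_over K g, logarithmic_over K g | algebraic_over K g] ->
  [\/ exponential_over K' g, logarithmic_over K' g | algebraic_over K' g].
Proof.
move=> KK' [[s /KK' Ks E]|[s /KK' Ks E]|[P [PK P1 _] Pg]].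
- by constructor 1; exists s.
- by constructor 2; exists s.
- by constructor 3; apply: algebraic_overP Pg => //; apply: sub_all PK.
Qed.

(** The generators of the second chain are elementary over any larger field, so
    they can be adjoined to the end of the first chain. *)
Lemma elementary_compositum K K' : elementary_field K -> elementary_field K' ->
  exists M, [/\ elementary_field M, {subset K <= M} & {subset K' <= M}].
Proof.
move=> EK; elim=> [|K1 g _ [M [EM KM K1M]] step].
  by exists K; split=> //; exact: elementary_field_Cx.
exists (adjoin M g); split.
- by apply: elementary_step => //; exact: elementary_step_mono step.
- by move=> y /KM; exact: adjoin_sub.
- exact: adjoin_mono.
Qed.

(** ** Elementary functions as analytic functions *)

Lemma elementary_afun (h : R -> C) : elementary I h ->
  exists F K, [/\ elementary_field K, F%:F \in K & forall x, I x -> F x = h x].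
Proof.
move=> [hs [K [phi [EK Kphi [p [q [q0 E hqp]]]]]]].
have hA : analytic_on I h.
  apply: (@analytic_quotient I h p q) => //; first exact/eqP.
  by move=> x Ix; exact: smooth_continuous hs Ix.
exists (to_afun hA), K; split=> //; last by move=> x Ix; rewrite /= restrictE.
suff <- : phi = (to_afun hA)%:F by [].
rewrite E; apply: (canLR (mulfK _)); first by rewrite tofrac_eq0.
rewrite -tofracM; congr _%:F; apply: afunP => x Ix.
by rewrite afunME // -hqp //= restrictE.
Qed.

Lemma afun_elementary (h : R -> C) F K : elementary_field K -> F%:F \in K ->
  (forall x, I x -> h x = F x) -> elementary I h.
Proof.
move=> EK KF E; split.
  by apply: analytic_smooth; apply: analytic_ext (@afun_analytic _ F) => x /E.
exists K, F%:F; split=> //; exists F, 1; split; rewrite ?oner_neq0 ?divr1 //.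
by move=> x Ix; rewrite E // afun1E // Cmult_1_r.
Qed.

Lemma is_cderive_afun F x : I x -> is_cderive F x (CDerive F x).
Proof. by move=> Ix; apply: analytic_is_cderive; exact: afun_analytic. Qed.

Lemma mderiv_tofrac F : mderiv F%:F = (afun_deriv F)%:F.
Proof.
have d1 : afun_deriv (1 : afun I) = 0.
  by apply: (addrI (afun_deriv 1)); rewrite -{3}[1]mulr1 afun_derivM mulr1 mul1r addr0.
have := @mderivE I F 1 (oner_neq0 _).
by rewrite rmorph1 divr1 d1 mulr1 mulr0 subr0 expr1n rmorph1 divr1.
Qed.

(** The primitive of [h' / h] is analytic as [h] is and does not vanish; it is
    logarithmic over a field that contains [h]. *)
Lemma log_primitive K (h : R -> C) : elementary_field K -> elementary I h ->
  (forall x, I x -> h x <> RtoC 0) ->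
  exists L M, [/\ elementary_field M, {subset K <= M}, L%:F \in M &
    forall x, I x -> is_cderive L x (CDerive h x / h x)%C].
Proof.
move=> EK /elementary_afun[H [K' [EK' HK' HE]]] h0.
have H0 x : I x -> H x <> RtoC 0 by move=> Ix; rewrite HE //; exact: h0.
have [M [EM KM K'M]] := elementary_compositum EK EK'.
have [x0 Ix0] := interval_inhabited I.
pose dlog x := (CDerive H x / H x)%C.
have dlogA : analytic_on I dlog.
  move=> a Ia; apply: analytic_mult; last by apply: analytic_inv; [exact: afun_analytic|exact: H0].
  by apply: analytic_CDerive; exact: afun_analytic.
have D x : I x -> is_cderive (CInt dlog x0) x (dlog x).
  move=> Ix; apply: (@is_cderive_CInt I) => // y Iy.
  by apply: is_cderive_continuous; apply: analytic_is_cderive; exact: dlogA.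
pose L := to_afun (analytic_primitive D dlogA).
have DL x : I x -> is_cderive L x (dlog x).
  move=> Ix; apply: (@is_cderive_ext I (CInt dlog x0)) => //; last exact: (D).
  by move=> y Iy; rewrite /= restrictE.
exists L, (adjoin M L%:F); split.
- apply: elementary_step => //; constructor 2; exists H%:F; first exact: K'M.
  have HF0 : H%:F != 0.
    by rewrite tofrac_eq0; apply/eqP => E; apply: (H0 x0 Ix0); rewrite E afun0E.
  split=> //; rewrite !mderiv_tofrac; apply: (canRL (mulfK HF0)).
  rewrite -tofracM; congr _%:F; apply: afunP => x Ix.
  rewrite afunME // /afun_deriv [X in Cmult X _]restrictE // [RHS]restrictE //.
  rewrite (is_cderive_unique (DL x Ix)) /dlog; field; exact: H0.
- by move=> y /KM; exact: adjoin_sub.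
- exact: adjoin_gen.
- move=> x Ix; rewrite -(HE x Ix) -(CDerive_ext HE Ix); exact: DL.
Qed.

Lemma dlog_sum_primitive K n (c : nat -> C) (hs : nat -> R -> C) F :
  elementary_field K -> F%:F \in K ->
  (forall i, (1 <= i <= n)%N ->
    elementary I (hs i) /\ forall x, I x -> hs i x <> RtoC 0) ->
  exists G M, [/\ elementary_field M, G%:F \in M & forall x, I x ->
    is_cderive G x (sum_n_m (fun i => c i * (CDerive (hs i) x / hs i x)) 1 n
                    + CDerive F x)%C].
Proof.
move=> EK KF; elim: n => [_|n IH Hhs].
  exists F, K; split=> // x Ix; rewrite sum_n_m_zero; last by [].
  by rewrite Cplus_0_l; exact: is_cderive_afun.
have [i Hi|G [M [EM MG DG]]] := IH.
  by apply: Hhs; case/andP: Hi => -> /leqW.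
have [|hsE hs0] := Hhs n.+1; first by rewrite leqnn.
have [L [M' [EM' MM' M'L DL]]] := log_primitive EM hsE hs0.
have M'c := elementary_field_closed EM'.
exists (afun_const I (c n.+1) * L + G), M'; split=> //.
  rewrite rmorphD rmorphM; apply: divring_closed_add => //; last exact: MM'.
  by apply: divring_closed_mul => //; exact: elementary_field_const.
move=> x Ix.
apply: (@is_cderive_ext I (fun y => c n.+1 * L y + G y)%C) => //.
  by move=> y Iy; rewrite afunDE // afunME //= restrictE.
rewrite sum_n_Sm; last by apply/leP.
have := is_cderive_plus (is_cderive_scal (c n.+1) (DL x Ix)) (DG x Ix).
by congr is_cderive; rewrite /plus /=; ring.
Qed.

(** Liouville's condition exhibits an analytic primitive [F] in an elementary
    field, and the integral is [F x - F x0]. *)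
Lemma liouville_CInt_elementary (h : R -> C) x0 (z : C) : I x0 -> liouville I h ->
  elementary I (fun x => z * CInt h x0 x)%C.
Proof.
move=> Ix0 [n [c [hs [s [Hhs /elementary_afun[S [K [EK KS SE]]] E]]]]].
have [G [M [EM MG DG]]] := dlog_sum_primitive c EK KS Hhs.
have Mc := elementary_field_closed EM.
have DGh x : I x -> is_cderive G x (h x).
  by move=> Ix; rewrite E // -(CDerive_ext SE Ix); exact: DG.
have hA : analytic_on I h.
  apply: (analytic_ext (h := afun_deriv G)); last exact: afun_analytic.
  by move=> x Ix; rewrite /= restrictE //; exact/is_cderive_unique/DGh.
apply: (@afun_elementary _ (afun_const I z * (G + afun_const I (- G x0)%C)) M) => //.
  rewrite rmorphM rmorphD; apply: divring_closed_mul => //; first exact: elementary_field_const.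
  by apply: divring_closed_add => //; exact: elementary_field_const.
move=> x Ix; rewrite afunME // afunDE //= !restrictE // (CInt_is_cderive DGh) //.
by move=> y Iy; apply: is_cderive_continuous; apply: analytic_is_cderive; exact: hA.
Qed.

End ElementaryFields.

(** * The equation and its resolving functions *)

Section Flux.
Variables (I : ointerval) (x0 : R) (f : nat -> R -> C).
Local Open Scope C_scope.

(** [iterated j m.+1] is the resolving function [g_{j-m:j}]; starting one step
    earlier, from the constant 1, makes [u_1] the case [j = 1] of [u_j]. *)
Fixpoint iterated (j m : nat) (x : R) : C :=
  match m with
  | 0%N => 1
  | m'.+1 => CInt (fun s => iterated j m' s / f (j - m')%N s) x0 x
  end.

Lemma resolving_iterated i j : resolving f x0 i j = iterated j (j - i).+1.
Proof.
rewrite /resolving; elim: (j - i)%N => [|m IH]; first by rewrite /= subn0.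
by rewrite [LHS]/= IH.
Qed.

Hypothesis Ix0 : I x0.
Variables (k j : nat).
Hypothesis fP : forall i, (1 <= i <= k)%N ->
  smooth_on I (f i) /\ forall x, I x -> f i x <> 0.
Hypothesis jk : (1 <= j <= k)%N.

Lemma integrand_continuous m x : (m < j)%N -> I x ->
  ccontinuous (iterated j m) x ->
  ccontinuous (fun s => iterated j m s / f (j - m)%N s) x.
Proof.
move=> mj Ix H; have [|fs f0] := fP (i := (j - m)%N); first by lia.
apply: ccontinuous_mult => //; apply: ccontinuous_inv; last exact: f0.
exact: smooth_continuous fs Ix.
Qed.

Lemma iterated_continuous m x : (m <= j)%N -> I x -> ccontinuous (iterated j m) x.
Proof.
elim: m x => [|m IH] x mj Ix; first exact: is_cderive_continuous (is_cderive_const 1 x).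
apply: is_cderive_continuous; apply: (@is_cderive_CInt I) => // y Iy.
by apply: integrand_continuous => //; apply: IH => //; exact: ltnW.
Qed.

Lemma is_cderive_iterated m x : (m < j)%N -> I x ->
  is_cderive (iterated j m.+1) x (iterated j m x / f (j - m)%N x).
Proof.
move=> mj Ix; apply: (@is_cderive_CInt I) => // y Iy.
by apply: integrand_continuous => //; apply: iterated_continuous => //; exact: ltnW.
Qed.

(** Each application of [f_i d/dx] undoes one integration. *)
Lemma flux_iterated (z : C) i x : (i <= j)%N -> I x ->
  flux f (fun s => z * iterated j j s) i x = z * iterated j (j - i) x.
Proof.
elim: i x => [|i IH] x ij Ix; first by rewrite subn0.
have iE y : I y -> flux f (fun s => z * iterated j j s) i y
    = z * iterated j (j - i.+1).+1 y.
  by move=> Iy; rewrite IH 1?ltnW // -subSn // subSS.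
rewrite [LHS]/= (CDerive_ext iE Ix).
have mj : (j - i.+1 < j)%N by lia.
rewrite (is_cderive_unique (is_cderive_scal z (is_cderive_iterated mj Ix))).
have -> : (j - (j - i.+1))%N = i.+1 by exact: subKn.
have [|_ f0] := fP (i := i.+1); first by lia.
by field; exact: f0.
Qed.

Lemma CDerive_flux_iterated (z : C) i x : (j <= i)%N -> I x ->
  CDerive (flux f (fun s => z * iterated j j s) i) x = 0.
Proof.
move=> /subnK <-; elim: (i - j)%N x => [|n IH] x Ix.
  have E y : I y -> flux f (fun s => z * iterated j j s) j y = z.
    by move=> Iy; rewrite flux_iterated // subnn Cmult_1_r.
  by rewrite (CDerive_ext E Ix); exact/is_cderive_unique/is_cderive_const.
have E y : I y -> flux f (fun s => z * iterated j j s) (n.+1 + j) y = 0.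
  by move=> Iy; rewrite addSn /= IH // Cmult_0_r.
by rewrite (CDerive_ext E Ix); exact/is_cderive_unique/is_cderive_const.
Qed.

Lemma iterated_solution (T : Type) (phi : T -> C) :
  liouville I (fun x => iterated j j.-1 x / f 1%N x) ->
  let u := fun x t => phi t * CInt (fun s => iterated j j.-1 s / f 1%N s) x0 x in
  is_solution I k.+1 f u /\ elementary_wrt_x I u.
Proof.
move=> HL u.
have uE : elementary_wrt_x I u by move=> t; exact: liouville_CInt_elementary.
split=> // t; have [us _] := uE t; split=> // x Ix.
have -> : (fun s => u s t) = (fun s => phi t * iterated j j s).
  by rewrite /u; case: j jk => // n _; rewrite /= subSnn.
by apply: CDerive_flux_iterated => //; case/andP: jk.
Qed.

End Flux.

Local Open Scope C_scope.

Theorem proposition5p6 (I : ointerval) (x0 : R) (k : nat) (f : nat -> R -> C)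
    (T : Type) (phi : T -> C) :
  (2 <= k)%N -> I x0 ->
  (forall i, (1 <= i <= k - 1)%N ->
    smooth_on I (f i) /\ forall x, I x -> f i x <> 0) ->
  (forall j, (2 <= j <= k - 1)%N ->
    liouville I (fun x => resolving f x0 2 j x * (1 / f 1%N x)) ->
    let u := fun x t => phi t * CInt (fun s => resolving f x0 2 j s / f 1%N s) x0 x in
    is_solution I k f u /\ elementary_wrt_x I u) /\
  (liouville I (fun x => 1 / f 1%N x) ->
    let u := fun x t => phi t * CInt (fun s => 1 / f 1%N s) x0 x in
    is_solution I k f u /\ elementary_wrt_x I u).
Proof.
case: k => // k k2 Ix0; rewrite subSS subn0 => fP; split=> [j /andP[j2 jk] HL|HL].
- have gE : resolving f x0 2 j = iterated x0 f j j.-1.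
    by rewrite resolving_iterated; congr iterated; lia.
  rewrite gE; apply: iterated_solution => //; first by rewrite jk ltnW.
  rewrite -gE; suff <- : (fun x => resolving f x0 2 j x * (1 / f 1%N x)) =
    (fun x => resolving f x0 2 j x / f 1%N x) by [].
  by apply: funext => x; rewrite /Cdiv Cmult_1_l.
- by apply: (@iterated_solution I x0 f Ix0 k 1).
Qed.
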